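(* Let $W$ and $W'$ be right-angled Coxeter groups with generalized $\Theta$--graph nerves. If $W$ and $W'$ have commensurable Euler characteristic vectors, then $W$ and $W'$ are abstractly commensurable.
   Context: Two groups are abstractly commensurable if they contain isomorphic finite-index subgroups. For a finite simplicial graph $\Gamma$ with vertex set $S$ and edge set $E$, the right-angled Coxeter group associated to $\Gamma$ is $W_\Gamma=\langle s\in S\mid s^2=1 \text{ for all } s\in S,\ [s,t]=1\text{ for all }\{s,t\}\in E\rangle$; when $\Gamma$ is triangle-free, $\Gamma$ is the nerve of $W_\Gamma$. Generalized $\Theta$--graph: let $k\ge 3$ and $1\le n_1\le\cdots\le n_k$ be integers. Take the graph with two vertices of valence $k$ joined by $k$ edges $e_1,\dots,e_k$, and subdivide $e_i$ into $n_i+1$ edges by inserting $n_i$ new vertices, for each $i$. The result is $\Theta(n_1,\dots,n_k)$. Euler characteristic vector: for $\Theta=\Theta(n_1,\dots,n_k)$, the Euler characteristic vector of $W_\Theta$ is $(\chi_1,\dots,\chi_k)$ with $\chi_i=\frac{1-n_i}{4}$. Two vectors $v,w\in\mathbb{Q}^k$ (of the same length $k$) are commensurable if there exist non-zero integers $K$ and $L$ with $Kv=Lw$. *)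

(* Defs.v *)
From HB Require Import structures.
From mathcomp Require Import all_boot all_order all_algebra.
From mathcomp Require Import boolp classical_sets functions cardinality.
Set Implicit Arguments.
Unset Strict Implicit.
Unset Printing Implicit Defensive.
Local Open Scope classical_set_scope.

(* The signed letter [(s, false)] stands for the generator [s], and [(s, true)]
   for its formal inverse. *)
Notation word S := (seq (S * bool)).

Definition word_inv (S : Type) (u : word S) : word S :=
  rev [seq (x.1, ~~ x.2) | x <- u].

Section Presentation.
Variables (S : choiceType) (R : set (word S)).

(* The congruence on words whose classes are the elements of < S | R >. *)
Inductive pres_eq : word S -> word S -> Prop :=
| pres_refl u : pres_eq u u
| pres_sym u v : pres_eq u v -> pres_eq v u
| pres_trans u v w : pres_eq u v -> pres_eq v w -> pres_eq u w
| pres_cat u u' v v' :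
    pres_eq u u' -> pres_eq v v' -> pres_eq (u ++ v) (u' ++ v')
| pres_cancel s b : pres_eq [:: (s, b); (s, ~~ b)] [::]
| pres_rel r : R r -> pres_eq r [::].

Definition pres_eqb : rel (word S) := fun u v => `[< pres_eq u v >].

Fact pres_eqb_refl : reflexive pres_eqb.
Proof. by move=> u; apply/asboolP; exact: pres_refl. Qed.

Fact pres_eqb_sym : symmetric pres_eqb.
Proof. by move=> u v; apply/asboolP/asboolP; exact: pres_sym. Qed.

Fact pres_eqb_trans : transitive pres_eqb.
Proof. by move=> v u w /asboolP uv /asboolP vw; apply/asboolP/(pres_trans uv). Qed.

Canonical pres_equiv := EquivRel pres_eqb pres_eqb_refl pres_eqb_sym pres_eqb_trans.

Definition presented := {eq_quot pres_equiv}%qT.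
HB.instance Definition _ := EqQuotient.on presented.
HB.instance Definition _ := Choice.on presented.

Definition pres_class (u : word S) : presented := \pi_presented%qT u.

Lemma pres_classP u v : pres_class u = pres_class v <-> pres_eq u v.
Proof.
split; first by move=> /(@eqmodP _ pres_equiv) /asboolP.
by move=> uv; apply/(@eqmodP _ pres_equiv)/asboolP.
Qed.

Lemma pres_class_ex (x : presented) : exists u, x = pres_class u.
Proof. by exists (repr x); rewrite /pres_class reprK. Qed.

Lemma pres_word_invl u : pres_eq (word_inv u ++ u) [::].
Proof.
elim: u => [|[s b] u IHu]; first exact: pres_refl.
have -> : word_inv ((s, b) :: u) ++ (s, b) :: u =
    word_inv u ++ ([:: (s, ~~ b); (s, b)] ++ u).
  by rewrite /word_inv map_cons rev_cons -cats1 -catA.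
apply: (pres_trans _ IHu); apply: pres_cat; first exact: pres_refl.
apply: (@pres_cat _ [::] u u); last exact: pres_refl.
by have := pres_cancel s (~~ b); rewrite negbK.
Qed.

Lemma word_invK (u : word S) : word_inv (word_inv u) = u.
Proof.
rewrite /word_inv map_rev revK -map_comp -[RHS]map_id.
by apply: eq_map => -[s b] /=; rewrite negbK.
Qed.

Lemma pres_word_invr u : pres_eq (u ++ word_inv u) [::].
Proof. by have := pres_word_invl (word_inv u); rewrite word_invK. Qed.

Lemma pres_word_inv u v : pres_eq u v -> pres_eq (word_inv u) (word_inv v).
Proof.
move=> uv; apply: (@pres_trans _ (word_inv u ++ (v ++ word_inv v))).
  rewrite -[X in pres_eq X _]cats0; apply: pres_cat; first exact: pres_refl.
  exact/pres_sym/pres_word_invr.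
rewrite catA -[X in pres_eq _ X]cat0s; apply: pres_cat; last exact: pres_refl.
apply: (pres_trans _ (pres_word_invl u)).
by apply: pres_cat; [exact: pres_refl | exact: pres_sym].
Qed.

Definition pres_one : presented := pres_class [::].
Definition pres_inv (x : presented) : presented := pres_class (word_inv (repr x)).
Definition pres_mul (x y : presented) : presented :=
  pres_class (repr x ++ repr y).

Lemma pres_repr u : pres_eq (repr (pres_class u)) u.
Proof. by apply/pres_classP; rewrite /pres_class reprK. Qed.

Lemma pres_mulE u v :
  pres_mul (pres_class u) (pres_class v) = pres_class (u ++ v).
Proof. by apply/pres_classP; apply: pres_cat; exact: pres_repr. Qed.

Lemma pres_invE u : pres_inv (pres_class u) = pres_class (word_inv u).
Proof. by apply/pres_classP; apply: pres_word_inv; exact: pres_repr. Qed.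

Fact pres_mulA : associative pres_mul.
Proof.
move=> x y z; have [u ->] := pres_class_ex x; have [v ->] := pres_class_ex y.
by have [w ->] := pres_class_ex z; rewrite !pres_mulE catA.
Qed.

Fact pres_mul1g : left_id pres_one pres_mul.
Proof. by move=> x; have [u ->] := pres_class_ex x; rewrite pres_mulE. Qed.

Fact pres_mulg1 : right_id pres_one pres_mul.
Proof.
by move=> x; have [u ->] := pres_class_ex x; rewrite pres_mulE cats0.
Qed.

Fact pres_mulVg : left_inverse pres_one pres_inv pres_mul.
Proof.
move=> x; have [u ->] := pres_class_ex x.
by rewrite pres_invE pres_mulE; apply/pres_classP/pres_word_invl.
Qed.

Fact pres_mulgV : right_inverse pres_one pres_inv pres_mul.
Proof.
move=> x; have [u ->] := pres_class_ex x.
by rewrite pres_invE pres_mulE; apply/pres_classP/pres_word_invr.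
Qed.

HB.instance Definition _ := isGroup.Build presented
  pres_mulA pres_mul1g pres_mulg1 pres_mulVg pres_mulgV.

End Presentation.

Record sgraph := SGraph {
  vertex :> finType;
  edge : rel vertex;
  edge_sym : symmetric edge;
  edge_irr : irreflexive edge }.

Definition gen_word (S : Type) (s : S) : word S := [:: (s, false)].

Definition comm_word (S : Type) (s t : S) : word S :=
  word_inv (gen_word s) ++ word_inv (gen_word t) ++ gen_word s ++ gen_word t.

Definition racg_relators (G : sgraph) : set (word G) :=
  [set r | (exists s : G, r = gen_word s ++ gen_word s) \/
           (exists s t : G, edge s t /\ r = comm_word s t)].

Definition racg (G : sgraph) : groupType := presented (@racg_relators G).

Section Theta.
Variables (k : nat) (n : 'I_k -> nat).

(* [inl false] and [inl true] are the two vertices of valence [k]; the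
   [n i] vertices [inr (Tagged _ j)] with [j : 'I_(n i)] subdivide the edge
   [e_i]. *)
Definition theta_vertex : finType := (bool + {i : 'I_k & 'I_(n i)})%type.

(* The vertex at position [p <= n i + 1] on the subdivided edge [e_i], which
   runs from [inl false] (at 0) to [inl true] (at [n i + 1]). *)
Definition theta_walk (i : 'I_k) (p : nat) : theta_vertex :=
  if p is q.+1 then
    if insub q is Some j then inr (Tagged (fun i => 'I_(n i)) (j : 'I_(n i)))
    else inl true
  else inl false.

Definition theta_edge : rel theta_vertex := fun u v =>
  [exists i : 'I_k, exists p : 'I_(n i).+1,
    ((u == theta_walk i p) && (v == theta_walk i p.+1)) ||
    ((v == theta_walk i p) && (u == theta_walk i p.+1))].

Fact theta_edge_sym : symmetric theta_edge.
Proof. by move=> u v; do 2!apply: eq_existsb => ?; rewrite orbC. Qed.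

Fact theta_walk_neq i (p : 'I_(n i).+1) :
  theta_walk i p != theta_walk i p.+1.
Proof.
case: p => -[|p] p_lt; rewrite [nat_of_ord _]/=.
  by rewrite /theta_walk; case: insubP.
rewrite ltnS in p_lt; rewrite /theta_walk insubT.
case: insubP => [j _ jE|//]; apply/eqP => -[] /eqP.
by rewrite -tag_eqE /tag_eq eqxx /= tagged_asE -val_eqE /= jE -[_ == _]negbK
           neq_ltn ltnSn.
Qed.

Fact theta_edge_irr : irreflexive theta_edge.
Proof.
move=> u; apply/existsP => -[i /existsP[p]]; rewrite orbb => /andP[/eqP-> ].
by apply/negP/theta_walk_neq.
Qed.

Definition Theta : sgraph := SGraph theta_edge_sym theta_edge_irr.

End Theta.

Definition euler_vector (k : nat) (n : 'I_k -> nat) : 'rV[rat]_k :=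
  (\row_(i < k) ((1 - (n i)%:R) / 4))%R.

Definition commensurable_vectors (k : nat) (v w : 'rV[rat]_k) : Prop :=
  exists K L : int, [/\ K != 0, L != 0 & K%:~R *: v = L%:~R *: w]%R.

Section Commensurability.
Local Open Scope group_scope.

Definition is_subgroup (G : groupType) (H : set G) : Prop :=
  [/\ H 1, forall x y, H x -> H y -> H (x * y) & forall x, H x -> H x^-1].

Definition left_coset (G : groupType) (H : set G) (g : G) : set G :=
  [set g * h | h in H].

Definition finite_index (G : groupType) (H : set G) : Prop :=
  finite_set (range (left_coset H)).

(* Only the values of [f] on [H] matter. *)
Definition isomorphic_subgroups (G G' : groupType) (H : set G) (H' : set G') :=
  exists f : G -> G', set_bij H H' f /\
    forall x y, H x -> H y -> f (x * y) = f x * f y.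

Definition abstractly_commensurable (G G' : groupType) : Prop :=
  exists (H : set G) (H' : set G'),
    [/\ is_subgroup H, finite_index H, is_subgroup H', finite_index H'
      & isomorphic_subgroups H H'].

End Commensurability.

(* Main.v *)
(** Let [a], [b] be the two vertices of valence k and m_i = n_i - 1, so that
    the Euler characteristic vector is proportional to m. Gluing K successive
    mirror images of the chamber of W_Theta along the infinite dihedral group
    <a, b> gives a fundamental domain for a reflection subgroup of index K. On
    each of the k pieces, the last mirror of one copy is aligned with the first
    mirror of the next, so K(m_i + 1) - (K - 1) = K m_i + 1 mirrors remain
    besides the two ends: the subgroup is W_Theta for the vector K m. If
    K m = L m', then W and W' both contain this group with finite index.
    Injectivity comes from the cocycle [step] of the action of W on the K
    copies, which plays the role of Reidemeister-Schreier rewriting. *)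
Require Import Defs.
From mathcomp Require Import all_boot all_order all_algebra.
From mathcomp Require Import boolp classical_sets functions cardinality.
From mathcomp Require Import lra zify.
Set Implicit Arguments.
Unset Strict Implicit.
Unset Printing Implicit Defensive.
Import GRing.Theory Num.Theory.
Local Open Scope nat_scope.
Local Open Scope group_scope.

(** * Generators of a right-angled Coxeter group *)

Definition racg_gen (G : sgraph) (s : G) : racg G := pres_class _ (gen_word s).

Section RacgGenerators.
Variable G : sgraph.
Implicit Types (s t : G).

Let classM (u v : word G) :
  pres_class (@racg_relators G) (u ++ v) =
  (pres_class _ u : racg G) * (pres_class _ v : racg G).
Proof. exact/esym/pres_mulE. Qed.

Lemma racg_genK s : racg_gen s * racg_gen s = 1.
Proof.
rewrite -classM; apply/pres_classP/pres_rel; left; by exists s.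
Qed.

Lemma racg_genV s : (racg_gen s)^-1 = racg_gen s.
Proof. exact/mulg1_eq/racg_genK. Qed.

Let class_inv_gen s b : pres_class (@racg_relators G) [:: (s, b)] = racg_gen s.
Proof.
case: b => //.
by apply: etrans (racg_genV s); apply: esym; apply: (@pres_invE _ _ (gen_word s)).
Qed.

Lemma racg_gen_commute s t : edge s t -> commute (racg_gen s) (racg_gen t).
Proof.
move=> st; apply/commgP/eqP.
have /pres_classP : pres_eq (@racg_relators G) (comm_word s t) [::].
  by apply: pres_rel; right; exists s, t.
rewrite /comm_word !classM !class_inv_gen => E.
by rewrite commgEl conjgE !racg_genV.
Qed.

Lemma racg_ind (Q : racg G -> Prop) :
  Q 1 -> (forall x s, Q x -> Q (x * racg_gen s)) -> forall x, Q x.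
Proof.
move=> Q1 QM x; have [u ->] := pres_class_ex x.
elim/last_ind: u => [//|u [s b] IHu].
by rewrite -cats1 classM class_inv_gen; exact: QM.
Qed.

End RacgGenerators.

(** * Right actions of a right-angled Coxeter group and its universal property *)

Section RacgAction.
Variables (G : sgraph) (Z : Type) (P : Z -> Prop) (step : Z -> G -> Z).
Hypothesis stepP : forall z s, P z -> P (step z s).
Hypothesis stepK : forall z s, P z -> step (step z s) s = z.
Hypothesis stepC : forall z s t, P z -> edge s t ->
  step (step z s) t = step (step z t) s.

Let run z (u : word G) := foldl (fun z x => step z x.1) z u.

Let run_cat z u v : run z (u ++ v) = run (run z u) v.
Proof. exact: foldl_cat. Qed.

Let runP z u : P z -> P (run z u).
Proof. by elim: u z => //= x u IHu z Pz; exact/IHu/stepP. Qed.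

Let run_eq u v : pres_eq (@racg_relators G) u v ->
  forall z, P z -> run z u = run z v.
Proof.
elim=> {u v} [//|u v _ IH z Pz|u v w _ IHu _ IHv z Pz|||].
- by rewrite IH.
- by rewrite IHu// IHv.
- by move=> u u' v v' _ IHu _ IHv z Pz; rewrite !run_cat IHu// IHv//; exact: runP.
- by move=> s b z Pz; exact: stepK.
- move=> r [[s ->]|[s [t [st ->]]]] z Pz; first exact: stepK.
  rewrite /comm_word /word_inv /= (stepC _ st) ?stepK//; first exact: stepP.
  exact/stepP/stepP.
Qed.

(** The representative chosen by [repr] is harmless on points satisfying [P]: there [run_eq] makes
    the result depend on the class only. *)
Definition racg_act (z : Z) (x : racg G) : Z := run z (repr (x : presented _)).

Let act_class z u : P z -> racg_act z (pres_class _ u) = run z u.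
Proof. by apply: run_eq; exact: pres_repr. Qed.

Lemma racg_actP z x : P z -> P (racg_act z x).
Proof. exact: runP. Qed.

Lemma racg_act1 z : P z -> racg_act z 1 = z.
Proof. exact: act_class. Qed.

Lemma racg_actM z x y : P z -> racg_act z (x * y) = racg_act (racg_act z x) y.
Proof.
by move=> Pz; rewrite [LHS](act_class (_ ++ _) Pz) run_cat.
Qed.

Lemma racg_act_gen z s : P z -> racg_act z (racg_gen s) = step z s.
Proof. exact: act_class. Qed.

Lemma racg_actKV z x : P z -> racg_act (racg_act z x) x^-1 = z.
Proof. by move=> Pz; rewrite -racg_actM// mulgV racg_act1. Qed.

Lemma racg_act_equivariant (h : Z -> Z) :
  (forall z, P z -> P (h z)) ->
  (forall z s, P z -> step (h z) s = h (step z s)) ->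
  forall z x, P z -> racg_act (h z) x = h (racg_act z x).
Proof.
move=> Ph hstep z x Pz; elim/racg_ind: x => [|x s IH].
  by rewrite !racg_act1//; exact: Ph.
have Px := racg_actP x Pz; have Phx := Ph _ Px.
by rewrite !racg_actM ?IH ?racg_act_gen ?hstep//; exact: Ph.
Qed.

End RacgAction.

(** Let the group act on [H] by right multiplication by the [f s] and follow the orbit of 1. This is
    a morphism because left translations commute with the action. *)
Lemma racg_lift (G : sgraph) (H : groupType) (f : G -> H) :
  (forall s, f s * f s = 1) ->
  (forall s t, edge s t -> commute (f s) (f t)) ->
  exists phi : racg G -> H,
    {morph phi : x y / x * y} /\ forall s, phi (racg_gen s) = f s.
Proof.
move=> fK fC; pose step (z : H) s := z * f s; pose P (z : H) := True.
have stepP z s : P z -> P (step z s) by [].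
have stepK z s : P z -> step (step z s) s = z.
  by move=> _; rewrite /step -mulgA fK mulg1.
have stepC z s t : P z -> edge s t -> step (step z s) t = step (step z t) s.
  by move=> _ /fC st; rewrite /step -!mulgA st.
exists (racg_act step 1); split=> [x y|s]; last first.
  by rewrite (racg_act_gen stepP stepK stepC)// /step mul1g.
rewrite (racg_actM stepP stepK stepC)//.
rewrite -{1}[racg_act step 1 x]mulg1.
by apply: (racg_act_equivariant stepP stepK stepC (h := *%g _)) => // z s _;
  rewrite /step mulgA.
Qed.

(** * Finite-index embeddings and commensurability *)

(* Injectivity is stated as the existence of a retraction, not assumed to be a
   morphism. *)
Definition virtual_embedding (G H : groupType) (phi : G -> H) : Prop :=
  [/\ {morph phi : x y / x * y}, exists psi : H -> G, cancel phi psi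
    & finite_index (range phi)].

Section Morphisms.
Variables (G H : groupType) (phi : G -> H).
Hypothesis phiM : {morph phi : x y / x * y}.

Lemma morph_1 : phi 1 = 1.
Proof. by apply: (mulgI (phi 1)); rewrite -phiM !mulg1. Qed.

Lemma morph_V x : phi x^-1 = (phi x)^-1.
Proof. by apply/esym/mulg1_eq; rewrite -phiM mulgV morph_1. Qed.

Lemma is_subgroup_range : is_subgroup (range phi).
Proof.
split; first by exists 1 => //; exact: morph_1.
- by move=> _ _ [x _ <-] [y _ <-]; exists (x * y).
- by move=> _ [x _ <-]; exists x^-1 => //; exact: morph_V.
Qed.

(** The hypothesis covers [H] by right cosets of the image; inversion turns them into left cosets
    with representatives [(d j)^-1]. *)
Lemma finite_index_range (K : nat) (d : nat -> H) :
  (forall x, exists g j, j < K /\ x = phi g * d j) -> finite_index (range phi).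
Proof.
move=> cover; rewrite /finite_index.
apply: (@sub_finite_set _ _ [set left_coset (range phi) (d j)^-1 | j in `I_K]);
  last exact/finite_image/finite_II.
move=> _ [x _ <-]; have [g [j [jK xE]]] := cover x^-1; exists j => //.
have {xE}-> : x = (d j)^-1 * phi g^-1.
  by rewrite morph_V -invgM -xE invgK.
apply/seteqP; split=> _ [_ [y _ <-] <-].
  by exists (phi (g * y)); [exists (g * y)|rewrite -mulgA -phiM mulKg].
by exists (phi (g^-1 * y)); [exists (g^-1 * y)|rewrite phiM mulgA].
Qed.

End Morphisms.

Lemma virtual_embedding_commensurable (G H H' : groupType)
    (phi : G -> H) (phi' : G -> H') :
  virtual_embedding phi -> virtual_embedding phi' -> abstractly_commensurable H H'.
Proof.
move=> [phiM [psi phiK] phi_fin] [phiM' [psi' phiK'] phi_fin'].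
exists (range phi), (range phi'); split => //; try exact: is_subgroup_range.
exists (phi' \o psi); split=> [|_ _ [x _ <-] [y _ <-]]; last first.
  by rewrite /= -phiM !phiK phiM'.
split=> [_ [x _ <-]|_ _ /set_mem[x _ <-] /set_mem[y _ <-]|_ [x _ <-]] /=.
- by rewrite phiK; exists x.
- by rewrite !phiK => /(can_inj phiK') ->.
- by exists (phi x); [exists x|rewrite /= phiK].
Qed.

(** * Walks along the subdivided edges *)

Local Arguments theta_walk : simpl never.

Section ThetaWalk.
Variables (k : nat) (n : 'I_k -> nat).

Lemma theta_walk_inr i (l : 'I_(n i)) :
  theta_walk n i l.+1 = inr (Tagged (fun i => 'I_(n i)) l).
Proof.
rewrite /theta_walk insubT //= => lt_l.
by congr (inr (Tagged _ _)); exact: val_inj.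
Qed.

Lemma theta_walk_end i : theta_walk n i (n i).+1 = inl true.
Proof. by rewrite /theta_walk insubN// ltnn. Qed.

Lemma theta_walk_edge i p :
  p <= n i -> edge (theta_walk n i p : Theta n) (theta_walk n i p.+1).
Proof.
move=> le_p; rewrite /edge /=; apply/existsP; exists i; apply/existsP.
by exists (Ordinal (n:=(n i).+1) (m:=p) le_p); rewrite !eqxx.
Qed.

Lemma theta_edge_ind (Q : Theta n -> Theta n -> Prop) :
  (forall s t, Q s t -> Q t s) ->
  (forall i p, p <= n i -> Q (theta_walk n i p) (theta_walk n i p.+1)) ->
  forall s t : Theta n, edge s t -> Q s t.
Proof.
move=> Qsym Qwalk s t /existsP[i /existsP[[p lt_p] /= /orP[] /andP[/eqP-> /eqP->]]].
  exact: Qwalk.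
exact/Qsym/Qwalk.
Qed.

End ThetaWalk.

(** * Unfolding [K] copies of the chamber: the action on pairs *)

Section Unfolding.
Variables (k : nat) (m : 'I_k -> nat) (K : nat).
Hypothesis K_gt0 : 0 < K.

Let n i := (m i).+1.
Let N i := (K * m i)%N.+1.
Let W := racg (Theta n).
Let V := racg (Theta N).
Implicit Types (g : V) (i : 'I_k) (j p q : nat) (b : bool).

Local Notation genN i p := (racg_gen (theta_walk N i p : Theta N)).
Local Notation genn i p := (racg_gen (theta_walk n i p : Theta n)).

(* Every other copy is reversed: position [q] of edge [e_i] in copy [j] sits at
   [mirror i j q] from the left end of that copy. *)
Let mirror i j q := if odd j then (m i).+2 - q else q.

Let mirrorK i j q : 0 < q <= n i -> mirror i j (mirror i j q) = q.
Proof. by rewrite /mirror /n; case: odd => //; lia. Qed.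

Let mirror_in i j q : 0 < q <= n i -> 0 < mirror i j q <= n i.
Proof. by rewrite /mirror /n; case: odd => //; lia. Qed.

(* Right multiplication by [s] on pairs [(g, j)], which stand for the elements
   [g * d j] of [W], [d j] being the transversal defined below. *)
Let step (z : V * nat) (s : Theta n) : V * nat :=
  let: (g, j) := z in
  match s with
  | inl b =>
    if b (+) odd j then
      if j.+1 == K then (g * racg_gen (inl true : Theta N), j) else (g, j.+1)
    else
      if j == 0%N then (g * racg_gen (inl false : Theta N), j) else (g, j.-1)
  | inr u =>
    let i := tag u in
    (g * genN i (j * m i + mirror i j (tagged u).+1)%N, j)
  end.

Let inside (z : V * nat) := z.2 < K.

Let step_inner g j i q : 0 < q <= n i ->
  step (g, j) (theta_walk n i q) =
  (g * genN i (j * m i + mirror i j q)%N, j).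
Proof.
case: q => // q lt_q.
by rewrite (theta_walk_inr (Ordinal lt_q : 'I_(n i))).
Qed.

Let step_inside z s : inside z -> inside (step z s).
Proof.
rewrite /inside; case: z => g j; case: s => [b|u] //= lt_j.
by case: ifP => _; case: eqP => //=; lia.
Qed.

Let step_invol z s : inside z -> step (step z s) s = z.
Proof.
rewrite /inside; case: z => g j; case: s => [b|u] /= lt_j; last first.
  by rewrite -mulgA racg_genK mulg1.
case: ifP => bj; case: eqP => jE /=; rewrite ?bj ?jE ?eqxx/=.
- by rewrite -mulgA racg_genK mulg1.
- by rewrite addbN bj.
- by rewrite -mulgA racg_genK mulg1.
- case: j jE bj lt_j => // j _ /=; rewrite addbN => /negbFE -> lt_j.
  by rewrite ltn_eqF.
Qed.

Let gen_walk_commute i p : p <= N i ->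
  commute (genN i p)
          (genN i p.+1).
Proof. by move=> /theta_walk_edge; exact: racg_gen_commute. Qed.

(** Here [t] is the neighbour of the end vertex on [e_i]. If [inl b] crosses into an adjacent copy,
    the position of [t] in [Theta N] is unchanged, since [j * m i + n i = j.+1 * m i + 1]; at an
    outer end, the relation of [V] applies. *)
Let step_end_commute z i b : inside z ->
  let t := theta_walk n i (if b then n i else 1%N) in
  step (step z (inl b)) t = step (step z t) (inl b).
Proof.
case: z => g j; rewrite /inside [_.2]/= => lt_j.
have mE j' : mirror i j' (if b then n i else 1%N) =
    if b (+) odd j' then n i else 1%N.
  by rewrite /mirror /n; case: b; case: odd => /=; lia.
have b_in : 0 < (if b then n i else 1%N) <= n i.
  by rewrite /n; case: (b); rewrite /= ?leqnn.
rewrite (step_inner _ _ b_in) /= mE.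
case: ifP => bj; case: eqP => jE; rewrite (step_inner _ _ b_in) mE /= ?bj//.
- congr (_, _); rewrite -!mulgA; congr (_ * _).
  have -> : (j * m i + n i = N i)%N by rewrite /n /N -jE; lia.
  by rewrite -(theta_walk_end N i) (gen_walk_commute (leqnn _)).
- by rewrite addbN bj /n /=; congr (_ * genN i _, _); lia.
- rewrite jE mul0n -!mulgA; congr (_ * _, _).
  exact: (@gen_walk_commute i 0%N).
- case: j jE bj {lt_j} => // j _ /=; rewrite addbN => /negbFE ->.
  by rewrite /n /=; congr (_ * genN i _, _); lia.
Qed.

Let step_commute z (s t : Theta n) : inside z -> edge s t ->
  step (step z s) t = step (step z t) s.
Proof.
move=> z_in st; move: s t st z z_in.
apply: theta_edge_ind => [s t IH z /IH//|i p le_p z z_in].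
have [->|p_gt0] := posnP p; first exact: (@step_end_commute z i false).
have [->|p_neq] := eqVneq p (n i).
  by rewrite theta_walk_end; exact/esym/(@step_end_commute z i true).
have p_in : 0 < p <= n i by lia.
have p1_in : 0 < p.+1 <= n i by lia.
case: z z_in => g j; rewrite /inside [_.2]/= => lt_j.
rewrite !step_inner// -!mulgA; congr (_ * _, _).
(* Neighbours in one copy land on consecutive positions of [Theta N], in reverse order when [j] is
   odd; [q] is the smaller one. *)
have [q [le_q qE]] : exists q, q <= N i /\
  (((j * m i + mirror i j p = q) /\ (j * m i + mirror i j p.+1 = q.+1)) \/
  ((j * m i + mirror i j p = q.+1) /\ (j * m i + mirror i j p.+1 = q)))%N.
  have : (j.+1 * m i <= K * m i)%N by rewrite leq_mul2r lt_j orbT.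
  rewrite /mirror /N; rewrite /n in p_in p1_in; case: odd => ?.
    by exists (j * m i + ((m i).+2 - p.+1))%N; split; [lia|right; lia].
  by exists (j * m i + p)%N; split; [lia|left; lia].
by case: qE => [[-> ->]|[-> ->]]; [|apply: esym]; exact: gen_walk_commute.
Qed.

Let act := racg_act step.
Let actM := racg_actM step_inside step_invol step_commute.
Let act_gen := racg_act_gen step_inside step_invol step_commute.
Let act1 := racg_act1 step_inside step_invol step_commute.
Let actKV := racg_actKV step_inside step_invol step_commute.

(** * The reflections in [W] that bound the unfolded domain *)

Let crossing j : W := racg_gen (inl (~~ odd j) : Theta n).

(** An alternating word of length [j] in the two end generators, starting with [inl true]; it
    carries the first copy to copy [j]. *)
Let d := fix d j : W := if j is j'.+1 then d j' * crossing j' else 1.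

(** The conjugate by [d j] of a generator: the reflection in a mirror of copy [j]. Here [q] counts
    from the left in every copy, so [q = 0] is the left wall. *)
Let refl i j q : W :=
  genn i (mirror i j q) ^ (d j)^-1.

Let wall j : W := racg_gen (inl (odd j) : Theta n) ^ (d j)^-1.

Let refl0 i j : refl i j 0%N = wall j.
Proof. by rewrite /refl /wall /mirror; case: odd; rewrite ?theta_walk_end. Qed.

(** Conjugation by [crossing j] separates the two sides. It fixes itself ([q = 0], the shared wall)
    and its neighbour on [e_i], with which it commutes ([q = 1], the aligned mirrors). *)
Let refl_fold i j q : q <= 1 -> refl i j.+1 q = refl i j ((m i).+2 - q).
Proof.
move=> le_q; rewrite /refl /= invgM conjgM racg_genV.
have -> : mirror i j ((m i).+2 - q) = mirror i j.+1 q.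
  by rewrite /mirror /=; case: odd => /=; lia.
congr (_ ^ _); apply/conjg_fixP/commgP.
case: q le_q => [|[]]// _; rewrite /crossing /mirror /=; case: odd => /=.
- by [].
- by rewrite subn0 theta_walk_end.
- apply: commute_sym; exact: racg_gen_commute (@theta_walk_edge _ n i 0%N _).
- rewrite subn1 -(theta_walk_end n i) /=.
  exact: racg_gen_commute (theta_walk_edge _).
Qed.

Let refl_commute i j q : q <= n i -> commute (refl i j q) (refl i j q.+1).
Proof.
move=> le_q; rewrite /refl /commute -!conjMg; congr (_ ^ _).
rewrite /mirror; case: odd; last exact: racg_gen_commute (theta_walk_edge _).
have -> : ((m i).+2 - q = ((m i).+2 - q.+1).+1)%N by rewrite /n in le_q; lia.
apply: commute_sym; apply: racg_gen_commute (theta_walk_edge _); rewrite /n; lia.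
Qed.

(* If [m i = 0] only [p = 1] occurs, and there [p.-1 %/ 0 = p.-1 %% 0 = 0]. *)
Let side i p : W := refl i (p.-1 %/ m i) (p.-1 %% m i).+1.

(** The last mirror of copy [j] and the first of copy [j.+1] have the same position; [refl_fold]
    makes their reflections agree. *)
Let sideE i j q : 0 < q <= n i -> side i (j * m i + q) = refl i j q.
Proof.
rewrite /side; case: q => // q; rewrite /n !ltnS /= => le_q; rewrite addnS /=.
have [m0|m_gt0] := posnP (m i).
  have {le_q}-> : q = 0%N by lia.
  rewrite m0 muln0; elim: j => [//|j IHj].
  by rewrite refl_fold// m0 -IHj.
have [lt_q|ge_q] := ltnP q (m i).
  by rewrite divnMDl// modnMDl divn_small// modn_small// addn0.
have -> : q = m i by lia.
by rewrite -mulSnr mulnK// modnMl refl_fold// subn1.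
Qed.

Let position_in i j q : j < K -> 0 < q <= n i -> 0 < j * m i + q <= N i.
Proof.
move=> lt_j; rewrite /n /N => q_in.
by have : (j.+1 * m i <= K * m i)%N; [rewrite leq_mul2r lt_j orbT|lia].
Qed.

Let side_ex i p : 0 < p <= N i ->
  exists j q, [/\ j < K, 0 < q <= n i & p = (j * m i + q)%N].
Proof.
rewrite /N /n => p_in; have [m0|m_gt0] := posnP (m i).
  by exists 0%N, 1%N; split => //; lia.
have [pE|p_neq] := eqVneq p (K * m i).+1.
  (* Division would place this last position in the nonexistent copy [K]. *)
  exists K.-1, (m i).+1; split; try lia.
  by case: K K_gt0 pE => //= K' _ ->; lia.
exists (p.-1 %/ m i), (p.-1 %% m i).+1.
have := ltn_pmod p.-1 m_gt0; have := divn_eq p.-1 (m i).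
by rewrite ltn_divLR//; split; lia.
Qed.

Let emb_gen (t : Theta N) : W :=
  match t with
  | inl b => wall (if b then K else 0%N)
  | inr u => side (tag u) (tagged u).+1
  end.

Let emb_gen_inner i p : 0 < p <= N i -> emb_gen (theta_walk N i p) = side i p.
Proof.
case: p => // p lt_p.
by rewrite (theta_walk_inr (Ordinal lt_p : 'I_(N i))).
Qed.

Let emb_genK t : emb_gen t * emb_gen t = 1.
Proof. by case: t => [b|u]; rewrite -conjMg racg_genK conj1g. Qed.

Let emb_gen_commute (s t : Theta N) : edge s t -> commute (emb_gen s) (emb_gen t).
Proof.
move: s t; apply: theta_edge_ind => [s t /commute_sym//|i p le_p].
have [->|p_gt0] := posnP p.
  rewrite (@emb_gen_inner i 1%N)// [emb_gen _]/= -(refl0 i) (@sideE i 0%N 1%N)//.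
  exact: refl_commute.
have [->|p_neq] := eqVneq p (N i).
  rewrite theta_walk_end (@emb_gen_inner i (N i)) ?leqnn//.
  rewrite [emb_gen (inl _)]/= -(refl0 i).
  rewrite /N -addn1 sideE//.
  exact/commute_sym/refl_commute.
rewrite !emb_gen_inner; try lia.
have m_gt0 : 0 < m i by move: p_gt0 p_neq le_p; rewrite /N; case: (m i) => //; lia.
have lt_mod := ltn_pmod p.-1 m_gt0.
(* Both positions are read in the copy of [p], so that [refl_commute] applies even if [p.+1] also
   begins the next copy. *)
have -> : p.+1 = (p.-1 %/ m i * m i + (p.-1 %% m i).+2)%N.
  by have := divn_eq p.-1 (m i); lia.
by rewrite sideE; [apply: refl_commute|]; rewrite /n; lia.
Qed.

(** * The retraction and the transversal *)

Let act_d g j : j < K -> act (g, 0%N) (d j) = (g, j).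
Proof.
elim: j => [|j IHj] lt_j; first exact: act1.
rewrite /act actM ?act_gen//; last by rewrite -/act IHj ?/inside//=; lia.
by rewrite -/act IHj ?(ltnW lt_j)//= addNb addbb /= ltn_eqF.
Qed.

(** The conjugate travels to copy [j], performs the step there and returns; by [act_d] the journey
    leaves the [V] coordinate alone. *)
Let act_conj_d g g' j (s : Theta n) : j < K -> step (g, j) s = (g', j) ->
  act (g, 0%N) (racg_gen s ^ (d j)^-1) = (g', 0%N).
Proof.
move=> lt_j sE; rewrite conjgE invgK mulgA /act !actM//.
rewrite -/act act_d// /act act_gen// sE.
by rewrite -[in LHS](act_d g' lt_j) actKV.
Qed.

Let wall_crossing j : wall j.+1 = racg_gen (inl (~~ odd j) : Theta n) ^ (d j)^-1.
Proof.
rewrite /wall /= invgM conjgM racg_genV; congr (_ ^ _).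
by rewrite conjgE racg_genK mulg1 racg_genV.
Qed.

(** On the first copy the subgroup acts by right multiplication of [V] on itself, so the orbit of
    [(1, 0)] recovers an element of [V] from its image. *)
Let act_emb_gen g t : act (g, 0%N) (emb_gen t) = (g * racg_gen t, 0%N).
Proof.
case: t => [[]|[i l]].
- rewrite /emb_gen -(prednK K_gt0) wall_crossing; apply: act_conj_d; first lia.
  by rewrite /= addNb addbb prednK// eqxx.
- exact: act_conj_d.
- have l_in : 0 < l.+1 <= N i := ltn_ord l.
  have [j [q [lt_j q_in lE]]] := side_ex l_in.
  rewrite /emb_gen /= lE sideE//; apply: act_conj_d => //.
  by rewrite step_inner ?mirror_in// mirrorK// -theta_walk_inr lE.
Qed.

(** The map sending [(g, j)] to [phi g * d j] intertwines [step] with right multiplication in [W],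
    so its image is all of [W] and the [d j] with [j < K] meet every right coset. *)
Let d_gen (phi : V -> W) (phiM : {morph phi : x y / x * y})
    (phi_gen : forall t, phi (racg_gen t) = emb_gen t) g j s : j < K ->
  phi g * d j * racg_gen s = phi (step (g, j) s).1 * d (step (g, j) s).2.
Proof.
move=> lt_j; case: s => [b|[i l]]; last first.
  have l_in : 0 < l.+1 <= n i := ltn_ord l.
  have ml_in := mirror_in j l_in.
  rewrite /= phiM phi_gen emb_gen_inner; last exact: position_in.
  rewrite sideE// /refl mirrorK// theta_walk_inr.
  by rewrite conjgE invgK -!mulgA mulVg mulg1.
rewrite /=; case: ifP => bj; case: eqP => jE /=.
- rewrite phiM phi_gen /emb_gen -jE wall_crossing conjgE invgK -!mulgA mulVg mulg1.
  by have -> : b = ~~ odd j by move: bj; case: (b); case: odd.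
- have -> : b = ~~ odd j by move: bj; case: (b); case: odd.
  by rewrite -mulgA.
- rewrite jE in bj *; rewrite phiM phi_gen /emb_gen /wall /= invg1 conjg1 !mulg1.
  by move: bj; case: (b).
- case: j jE bj {lt_j} => // j _ /=; rewrite addbN => /negbFE bj.
  have -> : b = ~~ odd j by move: bj; case: (b); case: odd.
  by rewrite -!mulgA racg_genK mulg1.
Qed.

Lemma Theta_virtual_embedding : exists phi : V -> W, virtual_embedding phi.
Proof.
have [phi [phiM phi_gen]] := racg_lift emb_genK emb_gen_commute.
exists phi; split => //.
  exists (fun x => (act (1, 0%N) x).1) => g.
  suff -> : act (1, 0%N) (phi g) = (g, 0%N) by [].
  elim/racg_ind: g => [|g s IHg]; first by rewrite morph_1// /act act1.
  by rewrite phiM phi_gen /act actM// -/act IHg act_emb_gen.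
apply: (finite_index_range phiM (K := K) (d := d)) => x.
elim/racg_ind: x => [|x s [g [j [lt_j ->]]]].
  by exists 1, 0%N; rewrite morph_1// mulg1.
exists (step (g, j) s).1, (step (g, j) s).2; split; last exact: d_gen.
exact: (@step_inside (g, j)).
Qed.

End Unfolding.

(** * From commensurable vectors to a common finite-index subgroup *)

Theorem corollary4p10 (k : nat) (n n' : 'I_k -> nat) :
  (3 <= k)%N ->
  (forall i, (1 <= n i)%N) ->
  (forall i j : 'I_k, (i <= j)%N -> (n i <= n j)%N) ->
  (forall i, (1 <= n' i)%N) ->
  (forall i j : 'I_k, (i <= j)%N -> (n' i <= n' j)%N) ->
  commensurable_vectors (euler_vector n) (euler_vector n') ->
  abstractly_commensurable (racg (Theta n)) (racg (Theta n')).
Proof.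
move=> _ n_gt0 _ n'_gt0 _ [K [L [K0 L0 KL]]].
(* The factor -1/4 cancels, and absolute values allow [K] and [L] of any sign because the [(n i).-1]
   are natural numbers. *)
have KLm i : (absz K * (n i).-1 = absz L * (n' i).-1)%N.
  have /rowP/(_ i) := KL; rewrite !mxE => KLi.
  suff : (K * (n i).-1%:Z = L * (n' i).-1%:Z)%R.
    by move=> /(congr1 absz); rewrite !abszM.
  apply: (@intr_inj rat); rewrite !rmorphM /= -!pmulrn.
  have := n_gt0 i; have := n'_gt0 i.
  case: (n i) (n' i) KLi => // a [//|b] KLi _ _ /=.
  move: KLi; rewrite -[a.+1%:R%R]natr1 -[b.+1%:R%R]natr1 => KLi.
  lra.
have nE (f : 'I_k -> nat) : (forall i, 1 <= f i) -> f = fun i => (f i).-1.+1.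
  by move=> f_gt0; apply/funext => i; rewrite prednK.
have K_gt0 : 0 < absz K by rewrite absz_gt0.
have L_gt0 : 0 < absz L by rewrite absz_gt0.
have [phi phiP] := Theta_virtual_embedding (fun i => (n i).-1) K_gt0.
have [phi' phiP'] := Theta_virtual_embedding (fun i => (n' i).-1) L_gt0.
rewrite (nE n n_gt0) (nE n' n'_gt0).
have E : (fun i => (absz K * (n i).-1).+1) = (fun i => (absz L * (n' i).-1).+1).
  by apply/funext => i; rewrite KLm.
(* By [E] both embeddings start from the same group. *)
move: phi phiP; rewrite E => phi phiP.
exact: virtual_embedding_commensurable phiP phiP'.
Qed.
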